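(* Let $n \ge 1$ and let $A = (a_{jk})_{j,k=1}^n$ be an $n \times n$ matrix with complex entries, regarded as an operator on $\mathbb{C}^n$ with the standard inner product. Then the Berezin range $B(A)$ is a convex subset of $\mathbb{C}$ if and only if $A$ has constant diagonal, i.e. $a_{11} = a_{22} = \cdots = a_{nn}$.
   Context: A reproducing kernel Hilbert space (RKHS) on a set $X$ is a Hilbert space $\mathcal{H}$ of functions $X \to \mathbb{C}$ for which every point evaluation $f \mapsto f(x)$, $x \in X$, is a bounded linear functional. The reproducing kernel at $x$ is the unique $k_x \in \mathcal{H}$ with $\langle f, k_x\rangle_{\mathcal{H}} = f(x)$ for all $f \in \mathcal{H}$, and $\hat{k}_x = k_x/\|k_x\|_{\mathcal{H}}$ is the normalized reproducing kernel. For a bounded linear operator $T$ on $\mathcal{H}$, the Berezin range of $T$ is $B(T) = \{\langle T\hat{k}_x, \hat{k}_x\rangle_{\mathcal{H}} : x \in X\} \subseteq \mathbb{C}$. Here $\mathbb{C}^n$ with the standard inner product is viewed as an RKHS on $X = \{1,\dots,n\}$ by identifying a vector $v = (v_1,\dots,v_n)$ with the function $v(j) = v_j$. The reproducing kernel at $j$ is then the $j$th standard basis vector $e_j$, so $\hat{k}_j = k_j = e_j$. *)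

(* Defs.v *)
From HB Require Import structures.
From mathcomp Require Import all_boot all_order all_algebra.
From mathcomp Require Import complex.
From mathcomp Require Import all_classical all_reals all_analysis.
Set Implicit Arguments.
Unset Strict Implicit.
Unset Printing Implicit Defensive.

Import Order.TTheory GRing.Theory Num.Theory Num.Def.
Import numFieldNormedType.Exports.

#[global] Open Scope classical_set_scope.
#[global] Open Scope ring_scope.

Definition dotnorm (C : numClosedFieldType) (U : lmodType C)
    (dot : {dot U for conjC}) (u : U) : C := sqrtC (dot u u).

(* Norms are C-valued; in [C] the hypothesis [0 < e] forces [e] to be real. *)
Definition dot_complete (C : numClosedFieldType) (U : lmodType C)
    (dot : {dot U for conjC}) : Prop :=
  forall u : nat -> U,
    (forall e : C, 0 < e -> exists N : nat, forall p q : nat,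
       (N <= p)%N -> (N <= q)%N -> dotnorm dot (u p - u q) < e) ->
    exists l : U, forall e : C, 0 < e -> exists N : nat, forall p : nat,
       (N <= p)%N -> dotnorm dot (u p - l) < e.

(* The elements of the space need not literally be functions: they are
   identified with functions on [X] through the injection [rk_eval]. *)
Record rkhs (R : realType) (X : Type) := RKHS {
  rk_space :> lmodType R[i];
  rk_dot : {dot rk_space for conjC};
  rk_complete : dot_complete rk_dot;
  rk_eval : rk_space -> X -> R[i];
  rk_eval_inj : injective rk_eval;
  rk_eval_linear : forall x, scalar (fun f => rk_eval f x);
  rk_eval_bounded : forall x, exists M : R[i], forall f,
    `|rk_eval f x| <= M * dotnorm rk_dot f
}.

Record bounded_op (R : realType) (X : Type) (H : rkhs R X) := BoundedOp {
  bop :> {linear H -> H};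
  bop_bounded : exists M : R[i], forall f,
    dotnorm (rk_dot H) (bop f) <= M * dotnorm (rk_dot H) f
}.

Definition is_reproducing_kernel (R : realType) (X : Type) (H : rkhs R X)
    (x : X) (k : H) : Prop :=
  forall f : H, rk_dot H f k = rk_eval f x.

(* If [k = 0], i.e. every function of [H] vanishes at the point, this is [0]. *)
Definition rk_normalize (R : realType) (X : Type) (H : rkhs R X) (k : H) : H :=
  (dotnorm (rk_dot H) k)^-1 *: k.

(* The kernel at [x] is referred to through its characterization; it is unique by
   [reproducing_kernel_uniq]. *)
Definition berezin_range (R : realType) (X : Type) (H : rkhs R X)
    (T : bounded_op H) : set R[i] :=
  [set z | exists (x : X) (k : H), is_reproducing_kernel x k /\
     z = rk_dot H (T (rk_normalize k)) (rk_normalize k)].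

Lemma reproducing_kernel_uniq (R : realType) (X : Type) (H : rkhs R X) (x : X)
    (k k' : H) :
  is_reproducing_kernel x k -> is_reproducing_kernel x k' -> k = k'.
Proof.
move=> hk hk'; apply/eqP; rewrite -subr_eq0 -(dnorm_eq0 (rk_dot H)).
by rewrite linearBr subr_eq0; apply/eqP/(etrans (hk _))/esym/hk'.
Qed.

Definition cdot (C : numClosedFieldType) (n : nat) (u v : 'cV[C]_n) : C :=
  \sum_j u j 0 * (v j 0)^*.

Lemma cdot_bilinear (C : numClosedFieldType) (n : nat) :
  bilinear_for *%R (conjC \; *%R) (@cdot C n).
Proof.
split=> u a v w /=; rewrite /cdot mulr_sumr -big_split /=;
  apply: eq_bigr => j _; rewrite !mxE.
  by rewrite mulrDl mulrA.
by rewrite rmorphD rmorphM mulrDr mulrCA.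
Qed.

HB.instance Definition _ (C : numClosedFieldType) (n : nat) :=
  bilinear_isBilinear.Build C 'cV[C]_n 'cV[C]_n C *%R (conjC \; *%R)
    (@cdot C n) (cdot_bilinear C n).

Lemma cdot_hermitian (C : numClosedFieldType) (n : nat) (u v : 'cV[C]_n) :
  cdot u v = (-1) ^+ false * (cdot v u)^*.
Proof.
rewrite expr0 mul1r /cdot rmorph_sum; apply: eq_bigr => j _.
by rewrite rmorphM /= conjCK mulrC.
Qed.

HB.instance Definition _ (C : numClosedFieldType) (n : nat) :=
  isHermitianSesquilinear.Build C 'cV[C]_n false conjC (@cdot C n)
    (@cdot_hermitian C n).

Lemma cdotE (C : numClosedFieldType) (n : nat) (u : 'cV[C]_n) :
  cdot u u = \sum_j `|u j 0| ^+ 2.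
Proof. by apply: eq_bigr => j _; rewrite normCK. Qed.

Lemma cdot_gt0 (C : numClosedFieldType) (n : nat) (u : 'cV[C]_n) :
  u != 0 -> 0 < cdot u u.
Proof.
rewrite cdotE => u0; rewrite lt_def sumr_ge0 ?andbT; last first.
  by move=> j _; rewrite exprn_ge0.
apply: contra u0; rewrite psumr_eq0; last by move=> j _; rewrite exprn_ge0.
move=> /allP h; apply/eqP/matrixP => j k; rewrite ord1 mxE; apply/eqP.
by have := h j (mem_index_enum j); rewrite /= expf_eq0 normr_eq0.
Qed.

HB.instance Definition _ (C : numClosedFieldType) (n : nat) :=
  isDotProduct.Build C 'cV[C]_n (@cdot C n) (@cdot_gt0 C n).

Lemma dotnorm_sqr (C : numClosedFieldType) (n : nat) (u : 'cV[C]_n) :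
  dotnorm (@cdot C n) u ^+ 2 = \sum_j `|u j 0| ^+ 2.
Proof. by rewrite sqrtCK; exact: cdotE. Qed.

Lemma entry_le_dotnorm (C : numClosedFieldType) (n : nat) (u : 'cV[C]_n)
    (j : 'I_n) :
  `|u j 0| <= dotnorm (@cdot C n) u.
Proof.
rewrite -(@ler_pXn2r _ 2) ?nnegrE ?sqrt_dnorm_ge0 // dotnorm_sqr.
by rewrite (bigD1 j) //= lerDl sumr_ge0 // => k _; rewrite exprn_ge0.
Qed.

Lemma dotnorm_le_sum (C : numClosedFieldType) (n : nat) (u : 'cV[C]_n) :
  dotnorm (@cdot C n) u <= \sum_j `|u j 0|.
Proof.
have s0 (P : pred 'I_n) : 0 <= \sum_(j | P j) `|u j 0| by rewrite sumr_ge0.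
rewrite -(@ler_pXn2r _ 2) ?nnegrE ?sqrt_dnorm_ge0 // dotnorm_sqr.
rewrite expr2 mulr_suml; apply: ler_sum => j _.
by rewrite expr2 ler_wpM2l // (bigD1 j) //= lerDl.
Qed.

Lemma real_seq_complete (R : realType) (u : nat -> R) :
  (forall e : R, 0 < e -> exists N : nat, forall p q : nat,
     (N <= p)%N -> (N <= q)%N -> `|u p - u q| < e) ->
  exists l : R, forall e : R, 0 < e -> exists N : nat, forall p : nat,
     (N <= p)%N -> `|u p - l| < e.
Proof.
move=> cu; have cvu : cvgn u.
  apply: cauchy_cvg; apply: cauchy_exP => e e0.
  have [N hN] := cu _ e0; exists (u N).
  by exists N => // p /= Np; exact: hN.
exists (limn u) => e e0.
have /cvgrPdist_lt /(_ e e0) [N _ hN] : u @ \oo --> limn u by [].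
by exists N => p Np; rewrite distrC; exact: hN.
Qed.

Lemma complex_seq_complete (R : realType) (z : nat -> R[i]) :
  (forall e : R[i], 0 < e -> exists N : nat, forall p q : nat,
     (N <= p)%N -> (N <= q)%N -> `|z p - z q| < e) ->
  exists l : R[i], forall e : R[i], 0 < e -> exists N : nat, forall p : nat,
     (N <= p)%N -> `|z p - l| < e.
Proof.
move=> cz.
have nRe (w : R[i]) : (`|complex.Re w|%:C <= `|w|)%C.
  by rewrite normc_def lecR -sqrtr_sqr ler_wsqrtr // lerDl sqr_ge0.
have nIm (w : R[i]) : (`|complex.Im w|%:C <= `|w|)%C.
  by rewrite normc_def lecR -sqrtr_sqr ler_wsqrtr // lerDr sqr_ge0.
have [a ha] : exists l : R, forall e : R, 0 < e -> exists N : nat,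
    forall p : nat, (N <= p)%N -> `|complex.Re (z p) - l| < e.
  apply: real_seq_complete => e e0.
  have [|N hN] := cz (e%:C)%C; first by rewrite ltcR.
  exists N => p q Np Nq; rewrite -ltcR -raddfB.
  exact: le_lt_trans (nRe _) (hN _ _ Np Nq).
have [b hb] : exists l : R, forall e : R, 0 < e -> exists N : nat,
    forall p : nat, (N <= p)%N -> `|complex.Im (z p) - l| < e.
  apply: real_seq_complete => e e0.
  have [|N hN] := cz (e%:C)%C; first by rewrite ltcR.
  exists N => p q Np Nq; rewrite -ltcR -raddfB.
  exact: le_lt_trans (nIm _) (hN _ _ Np Nq).
exists (a +i* b)%C => e e0.
have [e' ee'] : exists e' : R, e = (e'%:C)%C.
  by apply/complex_realP; rewrite gtr0_real.
have e'0 : 0 < e' / 2 by rewrite divr_gt0 // -ltcR -ee'.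
have [N1 h1] := ha _ e'0; have [N2 h2] := hb _ e'0.
exists (maxn N1 N2) => p; rewrite geq_max => /andP[/h1 {}h1 /h2 {}h2].
rewrite [z p - _]complexE ee' (le_lt_trans (ler_normD _ _)) //.
rewrite normrM !normc_def /= !expr0n /= !addr0 !add0r expr1n sqrtr1 mul1r.
rewrite !sqrtr_sqr -rmorphD ltcR [e']splitr !raddfB /=.
exact: ltrD.
Qed.

Lemma cdot_complete (R : realType) (n : nat) :
  dot_complete (@cdot R[i] n).
Proof.
move=> u cu.
have /choice[l hl] : forall j : 'I_n, exists l : R[i], forall e : R[i], 0 < e ->
    exists N : nat, forall p : nat, (N <= p)%N -> `|u p j 0 - l| < e.
  move=> j; apply: complex_seq_complete => e e0; have [N hN] := cu e e0.
  exists N => p q Np Nq; apply: le_lt_trans (hN _ _ Np Nq).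
  by have := entry_le_dotnorm (u p - u q) j; rewrite !mxE.
exists (\col_j l j) => e e0.
have e'0 : 0 < e / n.+1%:R by rewrite divr_gt0 // ltr0n.
have /choice[N hN] : forall j, exists N : nat, forall p : nat, (N <= p)%N ->
    `|u p j 0 - l j| < e / n.+1%:R by move=> j; exact: hl.
exists (\max_j N j) => p Np.
apply: le_lt_trans (dotnorm_le_sum _) _.
apply: (@le_lt_trans _ _ (\sum_(j < n) e / n.+1%:R)).
  apply: ler_sum => j _; rewrite !mxE ltW // hN //.
  exact: leq_trans (leq_bigmax j) Np.
rewrite sumr_const card_ord -[ltLHS]mulr_natl mulrCA -[ltRHS]mulr1.
by rewrite ltr_pM2l // ltr_pdivrMr ?ltr0n // mul1r ltr_nat.
Qed.

Definition col_eval (R : realType) (n : nat) (u : 'cV[R[i]]_n) (j : 'I_n) :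
  R[i] := u j 0.

Lemma col_eval_inj (R : realType) (n : nat) : injective (@col_eval R n).
Proof.
by move=> u v uv; apply/matrixP => j k; rewrite ord1; exact: (congr1 (@^~ j) uv).
Qed.

Lemma col_eval_linear (R : realType) (n : nat) (j : 'I_n) :
  scalar (fun u : 'cV[R[i]]_n => col_eval u j).
Proof. by move=> a u v; rewrite /col_eval !mxE. Qed.

Lemma col_eval_bounded (R : realType) (n : nat) (j : 'I_n) :
  exists M : R[i], forall u : 'cV[R[i]]_n,
    `|col_eval u j| <= M * dotnorm (@cdot R[i] n) u.
Proof. by exists 1 => u; rewrite mul1r entry_le_dotnorm. Qed.

Definition Cn (R : realType) (n : nat) : rkhs R 'I_n :=
  RKHS (@cdot_complete R n) (@col_eval_inj R n) (@col_eval_linear R n)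
    (@col_eval_bounded R n).

Lemma mulmx_bounded (R : realType) (n : nat) (A : 'M[R[i]]_n) :
  exists M : R[i], forall u : 'cV[R[i]]_n,
    dotnorm (@cdot R[i] n) (A *m u) <= M * dotnorm (@cdot R[i] n) u.
Proof.
exists (\sum_j \sum_k `|A j k|) => u; apply: le_trans (dotnorm_le_sum _) _.
rewrite mulr_suml; apply: ler_sum => j _; rewrite mxE mulr_suml.
apply: le_trans (ler_norm_sum _ _ _) _; apply: ler_sum => k _.
by rewrite normrM ler_wpM2l // entry_le_dotnorm.
Qed.

Definition mx_op (R : realType) (n : nat) (A : 'M[R[i]]_n) :
    bounded_op (Cn R n) :=
  @BoundedOp R 'I_n (Cn R n) (mulmx A) (mulmx_bounded A).

Lemma Cn_reproducing_kernel (R : realType) (n : nat) (j : 'I_n) :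
  @is_reproducing_kernel R 'I_n (Cn R n) j (delta_mx j 0).
Proof.
move=> u; rewrite /= /cdot (bigD1 j) //= !mxE !eqxx rmorph1 mulr1.
rewrite big1 ?addr0 // => k kj.
by rewrite mxE (negPf kj) rmorph0 mulr0.
Qed.

(* Main.v *)
Require Import Defs.
From mathcomp Require Import all_boot all_order all_algebra.
From mathcomp Require Import complex.
From mathcomp Require Import all_classical all_reals all_analysis.

(** The [j]th normalized reproducing kernel of [C^n] is the standard basis
    vector [e_j], and [<A e_j, e_j>] is the diagonal entry [a_jj]; so the
    Berezin range of a matrix is the set of its diagonal entries
    ([berezin_range_mx]). This set is finite. A convex set that contains two
    distinct points contains the segment between them, which is infinite, so a
    finite convex set has at most one point ([finite_convex_set_subsingleton]).
    Hence convexity forces the diagonal to be constant. Conversely, a constant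
    diagonal leaves at most one point in the range, and such a set is trivially
    convex. *)

Import Order.TTheory GRing.Theory Num.Theory Num.Def.
Local Open Scope classical_set_scope.
Local Open Scope ring_scope.

Lemma delta_mx_normalized (R : realType) (n : nat) (j : 'I_n) :
  @rk_normalize R 'I_n (Cn R n) (delta_mx j 0) = delta_mx j 0.
Proof.
rewrite /rk_normalize /dotnorm.
by rewrite (@Cn_reproducing_kernel R n j) /= /col_eval mxE !eqxx sqrtC1 invr1
  scale1r.
Qed.

Lemma berezin_range_mx (R : realType) (n : nat) (A : 'M[R[i]]_n) :
  berezin_range (mx_op A) = range (fun j : 'I_n => A j j).
Proof.
(* Pairing with the kernel [e_j] evaluates at [j], so [<A e_j, e_j>] is entry
   [j] of column [j] of [A]. *)
have diagE (j : 'I_n) : rk_dot (Cn R n)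
    (mx_op A (@rk_normalize R 'I_n (Cn R n) (delta_mx j 0)))
    (@rk_normalize R 'I_n (Cn R n) (delta_mx j 0)) = A j j.
  by rewrite delta_mx_normalized (@Cn_reproducing_kernel R n j) /= /col_eval
    -colE mxE.
apply/seteqP; split=> [z [j [k [kj ->]]]|z [j _ <-]].
  exists j => //.
  by rewrite (reproducing_kernel_uniq kj (@Cn_reproducing_kernel R n j)) diagE.
exists j, (delta_mx j 0); split; first exact: Cn_reproducing_kernel.
by rewrite diagE.
Qed.

Lemma conv_injective (K : numFieldType) (M : lmodType K)
    (x y : convex_lmodType M) :
  x != y -> injective (fun t : {i01 K} => conv t x y).
Proof.
move=> xy s t; have convE (r : {i01 K}) :
    conv r x y = r%:num *: ((x : M) - y) + (y : M).
  by rewrite scalerBr -addrA -[X in _ + (_ + X)]scale1r -scaleNr -scalerDl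
    [- _ + 1]addrC.
rewrite !convE => /addIr/eqP; rewrite -subr_eq0 -scalerBl scaler_eq0 !subr_eq0.
by rewrite (negPf xy) orbF => /eqP/val_inj.
Qed.

(** The infinitely many points [x / (k + 1) + k y / (k + 1)] of the segment
    are distinct when [x != y]. *)
Lemma finite_convex_set_subsingleton (K : numFieldType) (M : lmodType K)
    (A : set (convex_lmodType M)) (x y : convex_lmodType M) :
  finite_set A -> convex_set A -> x \in A -> y \in A -> x = y.
Proof.
move=> finA cvxA xA yA; apply: contrapT => /eqP xy.
have inv01 (k : nat) : 0 <= (k.+1%:R^-1 : K) <= 1.
  by rewrite invr_ge0 ler0n invf_le1 ?ltr0n // ler1n.
pose t k : {i01 K} := Itv01 (andP (inv01 k)).1 (andP (inv01 k)).2.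
have t_inj : injective t.
  move=> k l /(congr1 (fun s : {i01 K} => s%:num)) /= /invr_inj/eqP.
  by rewrite eqr_nat => /eqP[].
pose f k := conv (t k) x y.
have f_inj : injective f by move=> k l /(conv_injective _ _ _ _ xy)/t_inj.
apply: infinite_nat.
have -> : [set: nat] = f @^-1` A.
  by apply/esym/seteqP; split=> // k _; have := cvxA _ _ (t k) xA yA; rewrite inE.
by apply: finite_preimage => // ? ? _ _; exact: f_inj.
Qed.

Theorem proposition3p1 (R : realType) (n : nat) (hn : (1 <= n)%N)
    (A : 'M[R[i]]_n) :
  convex_set (berezin_range (mx_op A) : set (Rcomplex R)) <->
  (forall j k : 'I_n, A j j = A k k).
Proof.
rewrite berezin_range_mx; split=> [cvxA j k | diagA x y t].
  apply: (@finite_convex_set_subsingleton R (Rcomplex R) _ _ _ _ cvxA).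
  - exact: finite_image.
  - by rewrite inE; exists j.
  - by rewrite inE; exists k.
rewrite !inE => -[j _ <-] [k _ <-].
by rewrite (diagA k j) convmm; exists j.
Qed.
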